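(* Let $\mathfrak g=\mathrm T^*\mathfrak h_3$ be the Lie algebra with basis $e_1,\dots,e_6$ and non-zero commutators $[e_1,e_2]=e_6$, $[e_1,e_3]=-e_5$, $[e_2,e_3]=e_4$. For every subalgebra $\mathfrak h$ of $\mathfrak g$ there exists a left invariant pseudo-Riemannian metric on $\mathfrak g$ that makes $\mathfrak h$ totally geodesic.
   Context: A left invariant pseudo-Riemannian metric (of any signature) is identified with a non-degenerate symmetric bilinear form $\langle\cdot,\cdot\rangle$ on $\mathfrak g$, with Levi-Civita connection given on left invariant fields by $2\langle\nabla_xy,z\rangle=\langle[x,y],z\rangle-\langle[y,z],x\rangle+\langle[z,x],y\rangle$. A subalgebra $\mathfrak h$ is totally geodesic if $\nabla_yz\in\mathfrak h$ for all $y,z\in\mathfrak h$. *)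

(* Defs.v *)
From HB Require Import structures.
From mathcomp Require Import all_boot all_order all_algebra.
From mathcomp Require Import reals ring.

Set Implicit Arguments.
Unset Strict Implicit.
Unset Printing Implicit Defensive.

Import GRing.Theory Num.Theory.
Local Open Scope ring_scope.

Record lie_bracket (F : fieldType) (V : vectType F) := LieBracket {
  bracket :> V -> V -> V;
  bracket_linearl : forall z, linear (bracket^~ z);
  bracket_linearr : forall z, linear (bracket z);
  bracket_alt : forall x, bracket x x = 0;
  bracket_jacobi : forall x y z,
    bracket x (bracket y z) + bracket y (bracket z x)
      + bracket z (bracket x y) = 0 }.

Definition lie_subalgebra (F : fieldType) (V : vectType F)
    (br : lie_bracket V) (h : {vspace V}) : Prop :=
  {in h &, forall x y, br x y \in h}.

Definition is_levi_civita (F : fieldType) (V : vectType F)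
    (br : lie_bracket V) (g : {symmetric V}) (nabla : V -> V -> V) : Prop :=
  forall x y z,
    2 * g (nabla x y) z = g (br x y) z - g (br y z) x + g (br z x) y.

(* When g is non-degenerate and 2 is invertible, there is exactly one nabla    *)
(* satisfying the Koszul formula (levi_civita_exists, levi_civita_unique), so  *)
(* the existential quantifier below merely names it.                           *)
Definition totally_geodesic (F : fieldType) (V : vectType F)
    (br : lie_bracket V) (g : {symmetric V}) (h : {vspace V}) : Prop :=
  exists2 nabla, is_levi_civita br g nabla &
    {in h &, forall y z, nabla y z \in h}.

Section LeviCivita.
Variables (F : fieldType) (V : vectType F) (br : lie_bracket V).
Variable g : {symmetric V}.
Hypotheses (two_neq0 : 2 != 0 :> F) (ndg : nondegenerate g).

Lemma nondegenerate_inj u v : (forall z, g u z = g v z) -> u = v.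
Proof.
move=> guv; apply/eqP; rewrite -subr_eq0 -memv0 -(eqP ndg).
by apply/mem_orthovP => z _; rewrite linearBl /= guv subrr.
Qed.

Lemma levi_civita_unique nabla nabla' :
  is_levi_civita br g nabla -> is_levi_civita br g nabla' ->
  forall x y, nabla x y = nabla' x y.
Proof.
move=> lc lc' x y; apply: nondegenerate_inj => z.
by apply: (mulfI two_neq0); rewrite lc lc'.
Qed.

Lemma nondegenerate_riesz (phi : V -> F) :
  linear_for *%R phi -> {u | forall z, g u z = phi z}.
Proof.
move=> phiL.
pose b := vbasis {:V}.
have bP : basis_of {:V} b := vbasisP _.
pose T0 (u : V) : 'rV[F]_(\dim {:V}) := \row_i g u b`_i.
have T0L : linear T0.
  by move=> a u v; apply/rowP => i; rewrite !mxE linearPl.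
pose T0M := GRing.isLinear.Build _ _ _ _ T0 T0L.
pose T1 : {linear V -> 'rV[F]_(\dim {:V})} := HB.pack T0 T0M.
pose T := linfun T1.
have phi_sum n (c : 'I_n -> F) (w : 'I_n -> V) :
    phi (\sum_i c i *: w i) = \sum_i c i * phi (w i).
  have phi0 : phi 0 = 0.
    by have := phiL (-1) 0 0; rewrite scaler0 addr0 mulN1r addNr.
  elim: n c w => [|n IH] c w; first by rewrite !big_ord0.
  by rewrite !big_ord_recl phiL IH.
have Tb u psi : (forall i : 'I_(\dim {:V}), g u b`_i = psi b`_i) ->
    (forall n (c : 'I_n -> F) (w : 'I_n -> V),
      psi (\sum_i c i *: w i) = \sum_i c i * psi (w i)) ->
    forall z, g u z = psi z.
  move=> gb psiS z; rewrite (coord_basis bP (memvf z)) linear_sumr psiS.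
  by apply: eq_bigr => i _; rewrite linearZr /= gb.
have kerT : lker T == 0%VS.
  apply/lker0P => u v; rewrite !lfunE /= => /rowP Tuv.
  apply: nondegenerate_inj => z.
  apply: (Tb u (g v)) => [i|n c w]; first by have := Tuv i; rewrite !mxE.
  by rewrite linear_sumr; apply: eq_bigr => i _; rewrite linearZr.
have imT : limg T = fullv.
  apply/eqP; rewrite eqEdim subvf /= limg_dim_eq ?(eqP kerT) ?capv0 //.
  by rewrite !dimvf /dim /= mul1n.
pose r : 'rV[F]_(\dim {:V}) := \row_i phi b`_i.
have : r \in limg T by rewrite imT memvf.
move=> /limg_lfunVK Tr; exists ((T^-1)%VF r); apply: Tb => // i.
by have := congr1 (fun M : 'rV_ _ => M 0 i) Tr; rewrite lfunE /= !mxE.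
Qed.

Lemma levi_civita_exists : exists nabla, is_levi_civita br g nabla.
Proof.
pose k x y z := 2^-1 * (g (br x y) z - g (br y z) x + g (br z x) y).
have kL x y : linear_for *%R (k x y).
  move=> a u v; rewrite /k (bracket_linearl br x a u v).
  by rewrite (bracket_linearr br y a u v) !linearPl linearPr /=; ring.
exists (fun x y => sval (nondegenerate_riesz (kL x y))) => x y z.
by case: nondegenerate_riesz => u /= ->; rewrite /k mulVKf.
Qed.

End LeviCivita.

Section CotangentHeisenberg.
Variable R : realType.

(* 1-based: th3_basis i is the basis vector e_i of the text, 1 <= i <= 6 *)
Definition th3_basis (i : nat) : 'rV[R]_6 := delta_mx 0 (inord i.-1).
Local Notation e := th3_basis.

Definition th3_coord (x : 'rV[R]_6) (i : nat) : R := x 0 (inord i.-1).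
Local Notation "x .@ i" := (th3_coord x i) (at level 2, format "x .@ i").

Definition th3_bracket (x y : 'rV[R]_6) : 'rV[R]_6 :=
  (x.@1 * y.@2 - x.@2 * y.@1) *: e 6
  - (x.@1 * y.@3 - x.@3 * y.@1) *: e 5
  + (x.@2 * y.@3 - x.@3 * y.@2) *: e 4.

Lemma th3_linearl z : linear (th3_bracket^~ z).
Proof.
by move=> a x y; apply/rowP => j; rewrite /th3_bracket /th3_coord !mxE; ring.
Qed.

Lemma th3_linearr z : linear (th3_bracket z).
Proof.
by move=> a x y; apply/rowP => j; rewrite /th3_bracket /th3_coord !mxE; ring.
Qed.

Lemma th3_alt x : th3_bracket x x = 0.
Proof.
by apply/rowP => j; rewrite /th3_bracket /th3_coord !mxE; ring.
Qed.

Lemma th3_coord_basis i j : (0 < i <= 6)%N -> (0 < j <= 6)%N ->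
  (e i).@j = (j == i)%:R.
Proof.
case: i j => [|i] [|j] //= hi hj.
rewrite /th3_coord /th3_basis mxE eqxx /= -val_eqE /=.
by rewrite !inordK.
Qed.

Lemma th3_coord_bracket x y i : (0 < i <= 3)%N -> (th3_bracket x y).@i = 0.
Proof.
move=> hi; have [hi0 hi3] := andP hi.
have coord4 k : (3 < k <= 6)%N -> (e k).@i = 0.
  move=> /andP[k3 k6]; rewrite th3_coord_basis ?k6 ?(leq_trans _ k3)//.
    by rewrite ltn_eqF // (leq_ltn_trans hi3).
  by rewrite hi0 (leq_trans hi3).
move: (coord4 4 isT) (coord4 5 isT) (coord4 6 isT).
rewrite /th3_bracket /th3_coord !mxE => -> -> ->.
by rewrite !mulr0 subrr addr0.
Qed.

Lemma th3_jacobi x y z :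
  th3_bracket x (th3_bracket y z) + th3_bracket y (th3_bracket z x)
    + th3_bracket z (th3_bracket x y) = 0.
Proof.
suff nil2 u v w : th3_bracket u (th3_bracket v w) = 0 by rewrite !nil2 !addr0.
rewrite {1}/th3_bracket !th3_coord_bracket //.
by rewrite !mulr0 !subrr !scale0r subrr addr0.
Qed.

Definition th3 : lie_bracket 'rV[R]_6 :=
  LieBracket th3_linearl th3_linearr th3_alt th3_jacobi.

Lemma th3_e1e2 : th3 (e 1) (e 2) = e 6.
Proof.
by rewrite /= /th3_bracket !th3_coord_basis //=; apply/rowP => j;
  rewrite !mxE; ring.
Qed.

Lemma th3_e1e3 : th3 (e 1) (e 3) = - e 5.
Proof.
by rewrite /= /th3_bracket !th3_coord_basis //=; apply/rowP => j;
  rewrite !mxE; ring.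
Qed.

Lemma th3_e2e3 : th3 (e 2) (e 3) = e 4.
Proof.
by rewrite /= /th3_bracket !th3_coord_basis //=; apply/rowP => j;
  rewrite !mxE; ring.
Qed.

Lemma th3_eiej0 i j : (0 < i < j)%N -> (3 < j <= 6)%N -> th3 (e i) (e j) = 0.
Proof.
move=> /andP[i0 ij] /andP[j3 j6].
have j0 : (0 < j)%N by exact: leq_trans j3.
have i6 : (i <= 6)%N by exact: leq_trans (ltnW ij) j6.
have jn k : (k <= 3)%N -> (k == j) = false.
  by move=> k3; rewrite ltn_eqF // (leq_ltn_trans k3).
rewrite /= /th3_bracket !th3_coord_basis ?i0 ?j0 //= !jn //.
by rewrite !mulr0 !subrr !scale0r subrr addr0.
Qed.

End CotangentHeisenberg.

(* Main.v *)
Require Import Defs.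
From HB Require Import structures.
From mathcomp Require Import all_boot all_order all_algebra.
From mathcomp Require Import reals ring.

Import GRing.Theory Num.Theory.
Local Open Scope ring_scope.

(* T^*h_3 carries an ad-invariant metric, the duality pairing between
   span(e_1, e_2, e_3) and span(e_4, e_5, e_6). For an ad-invariant metric the
   Levi-Civita connection is half the bracket, so this single metric makes
   every subalgebra totally geodesic. *)

Definition ad_invariant {F : fieldType} {V : vectType F} (br : lie_bracket V)
    (g : V -> V -> F) : Prop :=
  forall x y z, g (br x y) z = g x (br y z).

Section AdInvariant.
Variables (F : fieldType) (V : vectType F) (br : lie_bracket V).
Variable g : {symmetric V}.

Lemma symmetric_formC x y : g x y = g y x.
Proof. by rewrite hermitian_subproof expr0 mul1r. Qed.

Hypotheses (two_neq0 : 2 != 0 :> F) (ad_g : ad_invariant br g).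

(** Ad-invariance and symmetry make all three terms on the right of the Koszul formula equal to
    [g (br x y) z]. The last two cancel, and the factor 2 on the left absorbs [2^-1]. *)
Lemma ad_invariant_levi_civita :
  is_levi_civita br g (fun x y => 2^-1 *: br x y).
Proof.
move=> x y z; rewrite linearZl_LR /= mulVKf //.
have -> : g (br y z) x = g (br x y) z by rewrite symmetric_formC ad_g.
have -> : g (br z x) y = g (br x y) z by rewrite ad_g symmetric_formC.
by rewrite subrr add0r.
Qed.

Lemma ad_invariant_totally_geodesic (h : {vspace V}) :
  lie_subalgebra br h -> totally_geodesic br g h.
Proof.
move=> h_sub; exists (fun x y => 2^-1 *: br x y).
  exact: ad_invariant_levi_civita.
by move=> x y xh yh; apply/memvZ/h_sub.
Qed.

End AdInvariant.

Section Th3Pairing.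
Variable R : realType.
Local Notation e := (th3_basis R).
Local Notation "x .@ i" := (@th3_coord R x i) (at level 2, format "x .@ i").

(** Each of [e 1], [e 2], [e 3] is paired with the vector whose index is 3 higher; the signature is
    (3,3). *)
Definition th3_pairing (x y : 'rV[R]_6) : R :=
  x.@1 * y.@4 + x.@2 * y.@5 + x.@3 * y.@6
  + x.@4 * y.@1 + x.@5 * y.@2 + x.@6 * y.@3.

Lemma th3_pairing_bilinear :
  bilinear_for (GRing.Scale.Law.clone _ _ *%R _)
    (GRing.Scale.Law.clone _ _ (idfun \; *%R) _) th3_pairing.
Proof.
by split=> [u'|u] a x y; rewrite /th3_pairing /th3_coord !mxE /=; ring.
Qed.

HB.instance Definition _ :=
  bilinear_isBilinear.Build R _ _ _ _ _ th3_pairing th3_pairing_bilinear.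

(** Sign exponent [false] and involution [idfun] encode plain symmetry, the form in which
    [{symmetric _}] expects it. *)
Lemma th3_pairing_hermitian x y :
  th3_pairing x y = (-1) ^+ false * idfun (th3_pairing y x).
Proof. by rewrite /th3_pairing /=; ring. Qed.

HB.instance Definition _ :=
  isHermitianSesquilinear.Build R _ false idfun th3_pairing
    th3_pairing_hermitian.

Lemma th3_row_eq0 (x : 'rV[R]_6) :
  (forall i, (0 < i <= 6)%N -> x.@i = 0) -> x = 0.
Proof.
(* The 0-based column [j] is the 1-based coordinate [j.+1]. *)
move=> x0; apply/rowP => j; rewrite mxE -(x0 j.+1 (ltn_ord j)).
by rewrite /th3_coord /= inord_val.
Qed.

Lemma th3_pairing_nondegenerate : nondegenerate th3_pairing.
Proof.
rewrite /nondegenerate -subv0; apply/subvP => x /mem_orthovP x_orth.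
have x0 i := x_orth (e i) (memvf _).
rewrite memv0; apply/eqP/th3_row_eq0.
case=> [|[|[|[|[|[|[|i]]]]]]] // _.
(* Pairing with the dual basis vector, whose index is shifted by 3, reads off one coordinate of
   [x]. *)
all: [> have := x0 4 | have := x0 5 | have := x0 6
      | have := x0 1 | have := x0 2 | have := x0 3 ];
  by rewrite /= /th3_pairing !th3_coord_basis //= !(mulr0, mulr1, addr0, add0r).
Qed.

(** Both sides are the determinant of the first three coordinates of [x], [y], [z], that is, a
    scalar triple product. *)
Lemma th3_pairing_ad_invariant : ad_invariant (th3 R) th3_pairing.
Proof.
(* Coordinates 4, 5, 6 of the bracket form the cross product of the first three coordinates; the
   minus sign in $[e_1,e_3]=-e_5$ is what matches it. *)
have brE u v : [/\ (th3 R u v).@4 = u.@2 * v.@3 - u.@3 * v.@2,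
    (th3 R u v).@5 = u.@3 * v.@1 - u.@1 * v.@3 &
    (th3 R u v).@6 = u.@1 * v.@2 - u.@2 * v.@1].
  have coord_br i : (th3 R u v).@i = (u.@1 * v.@2 - u.@2 * v.@1) * (e 6).@i
      - (u.@1 * v.@3 - u.@3 * v.@1) * (e 5).@i
      + (u.@2 * v.@3 - u.@3 * v.@2) * (e 4).@i.
    by rewrite /= /th3_bracket /th3_coord !mxE.
  by rewrite !coord_br !th3_coord_basis //=; split; ring.
move=> x y z; rewrite /th3_pairing.
have [-> -> ->] := brE x y; have [-> -> ->] := brE y z.
by rewrite !th3_coord_bracket //; ring.
Qed.

End Th3Pairing.

Theorem proposition4p9 (R : realType) (h : {vspace 'rV[R]_6})
    (h_sub : lie_subalgebra (th3 R) h) :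
  exists g : {symmetric 'rV[R]_6},
    nondegenerate g /\ totally_geodesic (th3 R) g h.
Proof.
exists (th3_pairing R); split; first exact: th3_pairing_nondegenerate.
apply: ad_invariant_totally_geodesic h_sub; first by rewrite pnatr_eq0.
exact: th3_pairing_ad_invariant.
Qed.
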